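(* Let $I$ be a non-empty set and let $(\mathcal{C},\mathbb{E},\mathfrak{s})$ be an essentially small AET4($I$) extriangulated category. Then, for any $n\geq1$, the maps (for $D=\{D_i\}_{i\in I}$ a family of objects in $\mathcal{C}$ and $C\in\mathcal{C}$) $$\tau^n_{D,C}:\mathbb{E}^n\Big(\coprod_{i\in I}D_i,C\Big)\to\prod_{i\in I}\mathbb{E}^n(D_i,C),\quad\eta\mapsto(\eta\cdot\mu_i^D)_{i\in I},$$ $$\sigma^n_{D,C}:\prod_{i\in I}\mathbb{E}^n(D_i,C)\to\mathbb{E}^n\Big(\coprod_{i\in I}D_i,C\Big),\quad(\eta_i)_{i\in I}\mapsto\nabla_C\cdot\Gamma_S^n(\eta_i)_{i\in I},$$ define natural isomorphisms such that $\tau^n$ is the inverse of $\sigma^n$.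
   Context: **Extriangulated categories (Nakaoka–Palu).** An extriangulated category is a triple $(\mathcal{C},\mathbb{E},\mathfrak{s})$: $\mathcal{C}$ is an additive category, $\mathbb{E}:\mathcal{C}^{op}\times\mathcal{C}\to\mathrm{Ab}$ is an additive bifunctor (for $\delta\in\mathbb{E}(C,A)$, $a:A\to A'$, $c:C'\to C$ write $a\cdot\delta=\mathbb{E}(C,a)(\delta)$, $\delta\cdot c=\mathbb{E}(c,A)(\delta)$; the same notation is used for $\mathbb{E}^n$), and $\mathfrak{s}$ assigns to each $\delta\in\mathbb{E}(C,A)$ an equivalence class $\mathfrak{s}(\delta)=[A\xrightarrow{x}B\xrightarrow{y}C]$ (two sequences are equivalent if there is an isomorphism of middle terms compatible with the identities of $A$ and $C$), subject to: (i) $\mathfrak{s}(0)=[A\to A\oplus C\to C]$ (canonical maps) and $\mathfrak{s}(\delta\oplus\delta')=\mathfrak{s}(\delta)\oplus\mathfrak{s}(\delta')$; (ii) if $\mathfrak{s}(\delta)=[A\xrightarrow{x}B\xrightarrow{y}C]$, $\mathfrak{s}(\delta')=[A'\xrightarrow{x'}B'\xrightarrow{y'}C']$ and $a:A\to A'$, $c:C\to C'$ satisfy $a\cdot\delta=\delta'\cdot c$, there is $b:B\to B'$ with $bx=x'a$, $y'b=cy$; (iii) (ET3) in the same notation, if $bx=x'a$ there is $c$ with $cy=y'b$ and $a\cdot\delta=\delta'\cdot c$, and dually (ET3$^{op}$); (iv) (ET4) if $\mathfrak{s}(\delta)=[A\xrightarrow{f}B\xrightarrow{f'}D]$ and $\mathfrak{s}(\delta')=[B\xrightarrow{g}C\xrightarrow{g'}F]$,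 there are $\delta''\in\mathbb{E}(E,A)$ with $\mathfrak{s}(\delta'')=[A\xrightarrow{gf}C\xrightarrow{h'}E]$ and morphisms $d:D\to E$, $e:E\to F$ with $df'=h'g$, $eh'=g'$, $\mathfrak{s}(f'\cdot\delta')=[D\xrightarrow{d}E\xrightarrow{e}F]$, $\delta''\cdot d=\delta$, $f\cdot\delta''=\delta'\cdot e$, and dually (ET4$^{op}$). If $\mathfrak{s}(\delta)=[A\xrightarrow{x}B\xrightarrow{y}C]$, the sequence realizes $\delta$. **AET4($I$).** $\mu_i$ denotes canonical inclusions into coproducts, $A^{(I)}$ the coproduct of $I$ copies of $A$, and $\nabla_C:C^{(I)}\to C$ the codiagonal ($\nabla_C\circ\mu_i^C=1_C$ for all $i$). $\mathcal{C}$ is AET4($I$) if all coproducts of $I$-indexed families exist and there is a natural transformation of $\mathrm{Ab}$-valued functors (natural in $\{B_i\}_{i\in I}$ and $A$) $\Gamma:\prod_{i\in I}\mathbb{E}(B_i,A)\to\mathbb{E}(\coprod_{i\in I}B_i,A^{(I)})$ such that (1) if $\eta_i$ is realized by $A\xrightarrow{f_i}E_i\xrightarrow{g_i}B_i$ for all $i$, then $\Gamma(\eta_i)_{i\in I}$ is realized by $A^{(I)}\xrightarrow{\coprod f_i}\coprod E_i\xrightarrow{\coprod g_i}\coprod B_i$; (2) $\Gamma(\eta_i)_{i\in I}\cdot\mu_j^B=\mu_j^A\cdot\eta_j$ for all $j\in I$. **Higher extensions.** For an essentially small extriangulated category, with $|\mathcal{C}|$ a set of representatives of iso-classes of objects,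 put $\mathbb{E}^1=\mathbb{E}$ and let $\mathbb{E}^{n+1}(A,B)$ be the quotient of $\bigoplus_{C\in|\mathcal{C}|}\mathbb{E}(C,B)\otimes_{\mathbb{Z}}\mathbb{E}^n(A,C)$ by the subgroup generated by all $(\epsilon\cdot f)\otimes\epsilon'-\epsilon\otimes(f\cdot\epsilon')$ with $f:C'\to C$. Every element of $\mathbb{E}^{i+j}(A,B)$ can be written as a product $\epsilon\cdot\epsilon'$ (class of $\epsilon\otimes\epsilon'$) with $\epsilon\in\mathbb{E}^i(C,B)$, $\epsilon'\in\mathbb{E}^j(A,C)$. **The functor $S$ and $\Gamma_S^n$.** The category $\mathcal{D}=\mathrm{Fun}(I,\mathcal{C})$ of $I$-indexed families of objects ($I$ viewed as a discrete category) is extriangulated with $\mathbb{F}(D,D')=\prod_{i\in I}\mathbb{E}(D_i,D'_i)$ and componentwise realization; $S=\coprod_{i\in I}(-):\mathcal{D}\to\mathcal{C}$; $T:\mathcal{C}\to\mathcal{D}$ is the constant functor. $S$ is extriangulated via $\Gamma_S:\prod_{i\in I}\mathbb{E}(B_i,A_i)\to\mathbb{E}(\coprod B_i,\coprod A_i)$, $\Gamma_S(\eta_i)_{i\in I}=\pi\cdot\Gamma(\mu_i^A\cdot\eta_i)_{i\in I}$, where $\pi:(\coprod_{i\in I}A_i)^{(I)}\to\coprod_{i\in I}A_i$ is the morphism whose $j$-th component is $\coprod_{i}A_i\xrightarrow{\pi_j^A}A_j\xrightarrow{\mu_j^A}\coprod_iA_i$ ($\pi_j^A$ the natural projection); so $\Gamma_S(\eta_i)_{i\in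 I}$ is realized by the coproduct of realizations of the $\eta_i$. $\Gamma_S$ induces natural transformations $\Gamma_S^n:\mathbb{F}^n(D,D')\to\mathbb{E}^n(SD,SD')$ with $\Gamma_S^1=\Gamma_S$ and $\Gamma_S^{i+j}(\epsilon\cdot\epsilon')=\Gamma_S^i(\epsilon)\cdot\Gamma_S^j(\epsilon')$. Here $\prod_{i\in I}\mathbb{E}^n(D_i,C)$ is identified with $\mathbb{F}^n(D,TC)$, products of extensions being formed componentwise. *)

(* Defs.v *)
From HB Require Import structures.
From mathcomp Require Import all_boot all_algebra.
From mathcomp Require Import generic_quotient ring_quotient.
From mathcomp Require Import boolp classical_sets.
From mathcomp Require Import freeg.

Set Implicit Arguments.
Unset Strict Implicit.
Unset Printing Implicit Defensive.

Import GRing.Theory.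
Local Open Scope ring_scope.
Local Open Scope quotient_scope.

Local Notation "M ^z" := (zmodule M) (format "M ^z") : type_scope.

Reserved Notation "g \oc f" (at level 40, left associativity).
Reserved Notation "a *l d" (at level 40, left associativity).
Reserved Notation "d *r c" (at level 40, left associativity).

Definition dprod (I : Type) (G : I -> zmodType) : Type := forall i, G i.

Section DepProduct.
Variables (I : Type) (G : I -> zmodType).

Let dadd (f g : dprod G) : dprod G := fun i => f i + g i.
Let dopp (f : dprod G) : dprod G := fun i => - f i.
Let dzero : dprod G := fun i => 0.

Let daddA : associative dadd.
Proof. by move=> f g h; apply/functional_extensionality_dep => i; apply: addrA. Qed.
Let daddC : commutative dadd.
Proof. by move=> f g; apply/functional_extensionality_dep => i; apply: addrC. Qed.
Let dadd0 : left_id dzero dadd.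
Proof. by move=> f; apply/functional_extensionality_dep => i; apply: add0r. Qed.
Let daddN : left_inverse dzero dopp dadd.
Proof. by move=> f; apply/functional_extensionality_dep => i; apply: addNr. Qed.

HB.instance Definition _ := gen_eqMixin (dprod G).
HB.instance Definition _ := gen_choiceMixin (dprod G).
HB.instance Definition _ :=
  GRing.isZmodule.Build (dprod G) daddA daddC dadd0 daddN.

End DepProduct.

(* The abelian group with generators X and relations r = 0 for r in R. *)
Section Presentation.
Variables (X : choiceType) (R : {freeg X / int} -> Prop).

Definition gen_subgroup : {pred {freeg X / int}} :=
  fun z => `[< forall H : zmodClosed {freeg X / int},
                 (forall r, R r -> r \in H) -> z \in H >].

Let gen_subgroup_closed : zmod_closed gen_subgroup.
Proof.
split=> [|x y].
  by apply/asboolP => H _; apply: rpred0.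
move=> /asboolP hx /asboolP hy; apply/asboolP => H HR.
by apply: rpredB; [apply: hx|apply: hy].
Qed.

HB.instance Definition _ :=
  GRing.isZmodClosed.Build {freeg X / int} gen_subgroup gen_subgroup_closed.

Definition presented : zmodType := Quotient.quot gen_subgroup.

Definition pres_gen (x : X) : presented := \pi_(Quotient.quot gen_subgroup) << x >>.

(* The homomorphism with given values on generators, when it exists: the
   result is meaningful only if f respects the relations (pres_liftE). *)
Definition pres_lift (G : zmodType) (f : X -> G) (q : presented) : G :=
  fglift (f : X -> G^z) (repr (q : Quotient.quot gen_subgroup)).

Lemma pres_piB (x y : {freeg X / int}) :
  \pi_(Quotient.quot gen_subgroup) (x - y) =
  (\pi_(Quotient.quot gen_subgroup) x : presented) -
  (\pi_(Quotient.quot gen_subgroup) y : presented).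
Proof. by rewrite !piE. Qed.

Lemma gen_subgroupP z : R z -> z \in gen_subgroup.
Proof. by move=> hz; apply/asboolP => H; apply. Qed.

Lemma pres_rel z : R z -> \pi_(Quotient.quot gen_subgroup) z = 0 :> presented.
Proof.
move=> hz; have -> : (0 : presented) = \pi_(Quotient.quot gen_subgroup) 0.
  by rewrite !piE.
by apply/eqP; rewrite -Quotient.idealrBE subr0 gen_subgroupP.
Qed.

End Presentation.

Section PresentationMorphisms.
Variables (X : choiceType) (R : {freeg X / int} -> Prop) (G : zmodType).

Lemma freeg_morph_eq (f g : {freeg X / int} -> G) :
  zmod_morphism f -> zmod_morphism g ->
  (forall x, f << x >> = g << x >>) -> f =1 g.
Proof.
move=> hf hg hfg.
pose Fm := GRing.isZmodMorphism.Build _ _ f hf.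
pose Gm := GRing.isZmodMorphism.Build _ _ g hg.
pose fM : {additive _ -> _} := HB.pack f Fm.
pose gM : {additive _ -> _} := HB.pack g Gm.
have f0 : f 0 = 0 := raddf0 fM.
have g0 : g 0 = 0 := raddf0 gM.
have fD : {morph f : x y / x + y} := raddfD fM.
have gD : {morph g : x y / x + y} := raddfD gM.
have fMz k : {morph f : x / x *~ k} := raddfMz fM k.
have gMz k : {morph g : x / x *~ k} := raddfMz gM k.
apply: freeg_ind_dom0 => [|k x D _ _ IH]; first by rewrite f0 g0.
rewrite fD gD IH; congr (_ + _).
have -> : << k *g x >> = << x >> *~ k :> {freeg X / int}.
  by rewrite freegU_mulz intz.
by rewrite fMz gMz hfg.
Qed.

Lemma pres_eq (f g : presented R -> G) :
  zmod_morphism f -> zmod_morphism g ->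
  (forall x, f (pres_gen R x) = g (pres_gen R x)) -> f =1 g.
Proof.
move=> hf hg hfg; apply: quotW => z.
apply: (@freeg_morph_eq (fun z => f (\pi z)) (fun z => g (\pi z))) => // x y.
  by rewrite pres_piB hf.
by rewrite pres_piB hg.
Qed.

Variable f : X -> G.
Hypothesis fR : forall r, R r -> fglift (f : X -> G^z) r = 0.

Lemma pres_liftE z :
  pres_lift f (\pi_(Quotient.quot (gen_subgroup R)) z : presented R) =
  fglift (f : X -> G^z) z.
Proof.
pose F : {freeg X / int} -> G := fglift (f : X -> G^z).
have hF : zmod_morphism F := lift_is_additive (M := G^z) f.
pose FM : {additive _ -> _} := HB.pack F (GRing.isZmodMorphism.Build _ _ F hF).
pose K : pred {freeg X / int} := fun z => F z == 0.
have hK : zmod_closed K.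
  split=> [|x y]; first by apply/eqP; exact: (raddf0 FM).
  by move=> /eqP hx /eqP hy; apply/eqP; rewrite hF hx hy subrr.
pose KM : zmodClosed {freeg X / int} :=
  HB.pack K (GRing.isZmodClosed.Build _ K hK).
apply/eqP; rewrite -subr_eq0 /pres_lift -[fglift _ _]/(F _) -[fglift _ z]/(F z).
rewrite -hF; set w := repr _ - z.
have /asboolP/(_ KM) : w \in gen_subgroup R.
  by rewrite Quotient.idealrBE reprK.
by apply => r /fR hr; apply/eqP.
Qed.

Lemma pres_lift_gen x : pres_lift f (pres_gen R x) = f x.
Proof. by rewrite pres_liftE liftU scale1r. Qed.

Lemma pres_lift_morph : zmod_morphism (pres_lift (R := R) f).
Proof.
apply: quotW => x; apply: quotW => y.
by rewrite -pres_piB !pres_liftE; exact: (lift_is_additive (M := G^z) f).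
Qed.

End PresentationMorphisms.

Record preaddCat := PreaddCat {
  obj :> Type;
  hom : obj -> obj -> zmodType;
  idm : forall A, hom A A;
  mcomp : forall A B C, hom B C -> hom A B -> hom A C;
  comp1m : forall A B (f : hom A B), mcomp (idm B) f = f;
  compm1 : forall A B (f : hom A B), mcomp f (idm A) = f;
  compA : forall A B C D (h : hom C D) (g : hom B C) (f : hom A B),
    mcomp h (mcomp g f) = mcomp (mcomp h g) f;
  compBr : forall A B C (g : hom B C), zmod_morphism (fun f : hom A B => mcomp g f);
  compBl : forall A B C (f : hom A B), zmod_morphism (fun g : hom B C => mcomp g f)
}.
Arguments idm {p} A.
Notation "g \oc f" := (mcomp g f).

Section CategoryNotions.
Variable C : preaddCat.

Definition inverse_pair (A B : C) (f : hom A B) (g : hom B A) :=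
  g \oc f = idm A /\ f \oc g = idm B.

Definition isomorphic (A B : C) :=
  exists (f : hom A B) (g : hom B A), inverse_pair f g.

Record additiveStr := AdditiveStr {
  zob : C;
  zob_id : idm zob = 0;
  bip : C -> C -> C;
  binl : forall A B, hom A (bip A B);
  binr : forall A B, hom B (bip A B);
  bprl : forall A B, hom (bip A B) A;
  bprr : forall A B, hom (bip A B) B;
  bprl_binl : forall A B, bprl A B \oc binl A B = idm A;
  bprr_binr : forall A B, bprr A B \oc binr A B = idm B;
  bprl_binr : forall A B, bprl A B \oc binr A B = 0;
  bprr_binl : forall A B, bprr A B \oc binl A B = 0;
  bip_id : forall A B, binl A B \oc bprl A B + binr A B \oc bprr A B = idm (bip A B)
}.

(* A choice of representatives of the isomorphism classes of objects. The
   groups Ext below are indexed by rep, which therefore lies in the universe of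
   the carriers of zmodTypes, while C itself may be larger: this is what makes
   C essentially small. *)
Record skeleton := Skeleton {
  rep : Type;
  rep_obj : rep -> C;
  repP : forall A : C, exists! r : rep, isomorphic A (rep_obj r)
}.

(* Biadditive functors C^op x C -> Ab: (bi C A) is contravariant in C and
   covariant in A. *)
Record bifunctor := Bifunctor {
  bi :> C -> C -> zmodType;
  lact : forall X A A', hom A A' -> bi X A -> bi X A';
  ract : forall X X' A, bi X A -> hom X' X -> bi X' A;
  lact1 : forall X A (d : bi X A), lact (idm A) d = d;
  ract1 : forall X A (d : bi X A), ract d (idm X) = d;
  lactM : forall X A A' A'' (a' : hom A' A'') (a : hom A A') (d : bi X A),
    lact (a' \oc a) d = lact a' (lact a d);
  ractM : forall X X' X'' A (d : bi X A) (c : hom X' X) (c' : hom X'' X'),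
    ract d (c \oc c') = ract (ract d c) c';
  lractA : forall X X' A A' (a : hom A A') (d : bi X A) (c : hom X' X),
    ract (lact a d) c = lact a (ract d c);
  lactBr : forall X A A' (a : hom A A'), zmod_morphism (fun d : bi X A => lact a d);
  lactBl : forall X A A' (d : bi X A), zmod_morphism (fun a : hom A A' => lact a d);
  ractBl : forall X X' A (c : hom X' X), zmod_morphism (fun d : bi X A => ract d c);
  ractBr : forall X X' A (d : bi X A), zmod_morphism (fun c : hom X' X => ract d c)
}.

End CategoryNotions.

Arguments lact {C} b {X A A'} a d : rename.
Arguments ract {C} b {X X' A} d c : rename.
Notation "a *l d" := (lact _ a d).
Notation "d *r c" := (ract _ d c).
Arguments binl {C} a A B : rename.
Arguments binr {C} a A B : rename.
Arguments bprl {C} a A B : rename.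
Arguments bprr {C} a A B : rename.
Arguments rep_obj {C} s r : rename.

Section HigherExtensions.
Variables (C : preaddCat) (S : skeleton C).

Definition rep_of (A : C) : rep S := projT1 (cid (repP S A)).

Lemma rep_of_iso A : isomorphic A (rep_obj S (rep_of A)).
Proof. by rewrite /rep_of; case: cid => r []. Qed.

Definition to_rep (A : C) : hom A (rep_obj S (rep_of A)) :=
  projT1 (cid (rep_of_iso A)).

Definition from_rep (A : C) : hom (rep_obj S (rep_of A)) A :=
  projT1 (cid (projT2 (cid (rep_of_iso A)))).

Lemma to_repK A : inverse_pair (to_rep A) (from_rep A).
Proof. exact: projT2 (cid (projT2 (cid (rep_of_iso A)))). Qed.

Section Step.
Variables (E F : bifunctor C).

Definition tensor_gens (A B : C) : choiceType :=
  {classic {r : rep S & (E (rep_obj S r) B * F A (rep_obj S r))%type}}.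

Definition tgen (A B : C) (r : rep S) (e : E (rep_obj S r) B)
    (x : F A (rep_obj S r)) : tensor_gens A B :=
  existT _ r (e, x).

(* Biadditivity gives the direct sum over r of the tensor products over Z; the
   last relation makes it balanced over C. *)
Inductive tensor_rel (A B : C) : {freeg (tensor_gens A B) / int} -> Prop :=
| tensor_rel_l r (e e' : E (rep_obj S r) B) (x : F A (rep_obj S r)) :
    tensor_rel (<< tgen (e + e') x >> - (<< tgen e x >> + << tgen e' x >>))
| tensor_rel_r r (e : E (rep_obj S r) B) (x x' : F A (rep_obj S r)) :
    tensor_rel (<< tgen e (x + x') >> - (<< tgen e x >> + << tgen e x' >>))
| tensor_rel_bal r r' (f : hom (rep_obj S r') (rep_obj S r))
    (e : E (rep_obj S r) B) (x : F A (rep_obj S r')) :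
    tensor_rel (<< tgen (e *r f) x >> - << tgen e (f *l x) >>).

Definition tensor (A B : C) : zmodType := presented (@tensor_rel A B).

Definition tclass (A B : C) (r : rep S) (e : E (rep_obj S r) B)
    (x : F A (rep_obj S r)) : tensor A B :=
  pres_gen (@tensor_rel A B) (tgen e x).

Definition tlift (A B : C) (G : zmodType)
    (f : forall r : rep S, E (rep_obj S r) B -> F A (rep_obj S r) -> G) :
    tensor A B -> G :=
  pres_lift (R := @tensor_rel A B)
    (fun g => f (projT1 g) (projT2 g).1 (projT2 g).2).

(* The product of extensions through an arbitrary object X, moved to the
   representative of X. *)
Definition tensor_prod (A B X : C) (e : E X B) (x : F A X) : tensor A B :=
  tclass (e *r from_rep X) (to_rep X *l x).

Definition balanced (A B : C) (G : zmodType)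
    (f : forall r : rep S, E (rep_obj S r) B -> F A (rep_obj S r) -> G) :=
  [/\ forall r x, zmod_morphism (fun e => f r e x),
      forall r e, zmod_morphism (f r e) &
      forall r r' (h : hom (rep_obj S r') (rep_obj S r)) e x,
        f r' (e *r h) x = f r e (h *l x)].

Lemma zmorphD (U V : zmodType) (f : U -> V) :
  zmod_morphism f -> {morph f : x y / x + y}.
Proof.
move=> hf.
pose fM : {additive _ -> _} := HB.pack f (GRing.isZmodMorphism.Build _ _ f hf).
exact: (raddfD fM).
Qed.

Section Lift.
Variables (A B : C) (G : zmodType).
Variable f : forall r : rep S, E (rep_obj S r) B -> F A (rep_obj S r) -> G.
Hypothesis hf : balanced f.

Let fR r : tensor_rel r -> fglift
  ((fun g : tensor_gens A B => f (projT2 g).1 (projT2 g).2) : _ -> G^z) r = 0.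
Proof.
have [fl fr fb] := hf.
have hL := lift_is_additive (M := G^z)
  (fun g : tensor_gens A B => f (projT2 g).1 (projT2 g).2).
have hD := zmorphD hL.
by case=> *; rewrite hL ?hD !liftU !scale1r /= ?fb ?(zmorphD (fl _ _))
  ?(zmorphD (fr _ _)) subrr.
Qed.

Lemma tlift_class r (e : E (rep_obj S r) B) (x : F A (rep_obj S r)) :
  tlift f (tclass e x) = f e x.
Proof. exact: (pres_lift_gen fR). Qed.

Lemma tlift_morph : zmod_morphism (tlift f).
Proof. exact: (pres_lift_morph fR). Qed.

End Lift.

Lemma tensor_eq (A B : C) (G : zmodType) (f g : tensor A B -> G) :
  zmod_morphism f -> zmod_morphism g ->
  (forall r (e : E (rep_obj S r) B) (x : F A (rep_obj S r)),
    f (tclass e x) = g (tclass e x)) -> f =1 g.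
Proof.
by move=> hf hg hfg; apply: pres_eq => // -[r [e x]]; apply: hfg.
Qed.

Lemma tclass_balanced (A B : C) : balanced (@tclass A B).
Proof.
pose pi z : tensor A B := \pi_(Quotient.quot (gen_subgroup (@tensor_rel A B))) z.
have hpi : zmod_morphism pi by move=> x y; apply: pres_piB.
have hD := zmorphD hpi.
have gD (a b c : tensor_gens A B) : tensor_rel (<< a >> - (<< b >> + << c >>)) ->
    pi << a >> = pi << b >> + pi << c >>.
  move=> h; apply/eqP; rewrite -hD -subr_eq0 -hpi; apply/eqP.
  exact: pres_rel.
split.
- move=> r x e e'; have := gD _ _ _ (tensor_rel_l (e - e') e' x).
  rewrite subrK => h; apply: (@addIr _ (tclass e' x)).
  by rewrite subrK; exact: esym h.
- move=> r e x x'; have := gD _ _ _ (tensor_rel_r e (x - x') x').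
  rewrite subrK => h; apply: (@addIr _ (tclass e x')).
  by rewrite subrK; exact: esym h.
- move=> r r' h e x; apply/eqP; rewrite -subr_eq0; apply/eqP.
  rewrite -[LHS]/(pi _ - pi _) -hpi; apply: pres_rel.
  exact: tensor_rel_bal.
Qed.

Definition tensor_lact X A A' (a : hom A A') : tensor X A -> tensor X A' :=
  tlift (fun r e x => tclass (a *l e) x).

Definition tensor_ract X X' A (d : tensor X A) (c : hom X' X) : tensor X' A :=
  tlift (fun r e x => tclass e (x *r c)) d.

Lemma tensor_lact_balanced X A A' (a : hom A A') :
  balanced (fun r (e : E (rep_obj S r) A) (x : F X (rep_obj S r)) =>
              tclass (a *l e) x).
Proof.
have [tl tr tb] := tclass_balanced X A'; split=> [r x e e'|r e|r r' h e x].
- by rewrite lactBr tl.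
- exact: tr.
- by rewrite -lractA tb.
Qed.

Lemma tensor_ract_balanced X X' A (c : hom X' X) :
  balanced (fun r (e : E (rep_obj S r) A) (x : F X (rep_obj S r)) =>
              tclass e (x *r c)).
Proof.
have [tl tr tb] := tclass_balanced X' A; split=> [r x|r e x x'|r r' h e x].
- exact: tl.
- by rewrite ractBl tr.
- by rewrite tb lractA.
Qed.

Let tlE X A A' (a : hom A A') r (e : E (rep_obj S r) A) (x : F X (rep_obj S r)) :
  tensor_lact a (tclass e x) = tclass (a *l e) x.
Proof. exact/tlift_class/tensor_lact_balanced. Qed.

Let trE X X' A (c : hom X' X) r (e : E (rep_obj S r) A) (x : F X (rep_obj S r)) :
  tensor_ract (tclass e x) c = tclass e (x *r c).
Proof. exact: (tlift_class (tensor_ract_balanced _ _)). Qed.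

Let tlB X A A' (a : hom A A') : zmod_morphism (@tensor_lact X A A' a).
Proof. exact/tlift_morph/tensor_lact_balanced. Qed.

Let trB X X' A (c : hom X' X) : zmod_morphism (fun d => @tensor_ract X X' A d c).
Proof. exact: (tlift_morph (tensor_ract_balanced _ _)). Qed.

Let comp_morph (G H K : zmodType) (f : H -> K) (g : G -> H) :
  zmod_morphism f -> zmod_morphism g -> zmod_morphism (fun x => f (g x)).
Proof. by move=> hf hg x y; rewrite hg hf. Qed.

Let sub_morph (G H : zmodType) (f g : G -> H) :
  zmod_morphism f -> zmod_morphism g -> zmod_morphism (fun x => f x - g x).
Proof.
by move=> hf hg x y; rewrite hf hg !opprD !opprK addrACA [- _ + _]addrC.
Qed.

Let tl1 X A (d : tensor X A) : tensor_lact (idm A) d = d.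
Proof.
move: d; apply: (tensor_eq (f := tensor_lact (idm A)) (g := id)) => //.
by move=> r e x; rewrite tlE lact1.
Qed.

Let tr1 X A (d : tensor X A) : tensor_ract d (idm X) = d.
Proof.
move: d; apply: (tensor_eq (f := fun d => tensor_ract d _) (g := id)) => //.
by move=> r e x; rewrite trE ract1.
Qed.

Let tlM X A A' A'' (a' : hom A' A'') (a : hom A A') (d : tensor X A) :
  tensor_lact (a' \oc a) d = tensor_lact a' (tensor_lact a d).
Proof.
move: d; apply: (tensor_eq (g := fun d => tensor_lact a' (tensor_lact a d))).
- exact: tlB.
- by apply: comp_morph; apply: tlB.
by move=> r e x; rewrite !tlE lactM.
Qed.

Let trM X X' X'' A (d : tensor X A) (c : hom X' X) (c' : hom X'' X') :
  tensor_ract d (c \oc c') = tensor_ract (tensor_ract d c) c'.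
Proof.
move: d; apply: (tensor_eq (f := fun d => tensor_ract d _)
  (g := fun d => tensor_ract (tensor_ract d c) c')).
- exact: trB.
- by apply: (comp_morph (f := fun d => tensor_ract d c')); apply: trB.
by move=> r e x; rewrite !trE ractM.
Qed.

Let tlrA X X' A A' (a : hom A A') (d : tensor X A) (c : hom X' X) :
  tensor_ract (tensor_lact a d) c = tensor_lact a (tensor_ract d c).
Proof.
move: d; apply: (tensor_eq (f := fun d => tensor_ract (tensor_lact a d) c)
  (g := fun d => tensor_lact a (tensor_ract d c))).
- by apply: (comp_morph (f := fun d => tensor_ract d c));
    [apply: trB|apply: tlB].
- by apply: (comp_morph (g := fun d => tensor_ract d c));
    [apply: tlB|apply: trB].
by move=> r e x; rewrite trE !tlE trE.
Qed.

Let tlBl X A A' (d : tensor X A) :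
  zmod_morphism (fun a : hom A A' => tensor_lact a d).
Proof.
move=> a a'; move: d.
apply: (tensor_eq (g := fun d => tensor_lact a d - tensor_lact a' d)).
- exact: tlB.
- by apply: sub_morph; apply: tlB.
move=> r e x; rewrite !tlE lactBl.
by have [tl _ _] := tclass_balanced X A'; rewrite tl.
Qed.

Let trBr X X' A (d : tensor X A) :
  zmod_morphism (fun c : hom X' X => tensor_ract d c).
Proof.
move=> c c'; move: d.
apply: (tensor_eq (f := fun d => tensor_ract d (c - c'))
  (g := fun d => tensor_ract d c - tensor_ract d c')).
- exact: trB.
- by apply: sub_morph; apply: trB.
move=> r e x; rewrite !trE ractBr.
by have [_ tr _] := tclass_balanced X' A; rewrite tr.
Qed.

Definition tensor_bifunctor : bifunctor C :=
  @Bifunctor C tensor tensor_lact tensor_ract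
    tl1 tr1 tlM trM tlrA tlB tlBl trB trBr.

Lemma tlact_class X A A' (a : hom A A') r (e : E (rep_obj S r) A)
    (x : F X (rep_obj S r)) :
  lact tensor_bifunctor a (tclass e x) = tclass (a *l e) x.
Proof. exact: tlE. Qed.

Lemma tract_class X X' A (c : hom X' X) r (e : E (rep_obj S r) A)
    (x : F X (rep_obj S r)) :
  ract tensor_bifunctor (tclass e x) c = tclass e (x *r c).
Proof. exact: trE. Qed.

Lemma tensor_prodBl A B X (x : F A X) :
  zmod_morphism (fun e : E X B => tensor_prod e x).
Proof.
have [tl _ _] := tclass_balanced A B.
by move=> e e'; rewrite /tensor_prod ractBl tl.
Qed.

Lemma tensor_prodBr A B X (e : E X B) :
  zmod_morphism (fun x : F A X => tensor_prod e x).
Proof.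
have [_ tr _] := tclass_balanced A B.
by move=> x x'; rewrite /tensor_prod lactBr tr.
Qed.

Lemma tensor_prod_bal A B X X' (f : hom X' X) (e : E X B) (x : F A X') :
  tensor_prod (e *r f) x = tensor_prod e (f *l x).
Proof.
have [_ _ tb] := tclass_balanced A B; rewrite /tensor_prod.
have [fK _] := to_repK X; have [fK' _] := to_repK X'.
rewrite -[in RHS](lact1 x) -fK' -!lactM !compA lactM -tb; congr (tclass _ _).
by rewrite -!ractM !compA fK comp1m.
Qed.

Lemma tensor_prod_rep A B r (e : E (rep_obj S r) B) (x : F A (rep_obj S r)) :
  tensor_prod e x = tclass e x.
Proof.
have [_ _ tb] := tclass_balanced A B; have [fK _] := to_repK (rep_obj S r).
by rewrite /tensor_prod tb -lactM fK lact1.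
Qed.

Lemma tensor_prod_lact A B B' X (b : hom B B') (e : E X B) (x : F A X) :
  lact tensor_bifunctor b (tensor_prod e x) = tensor_prod (b *l e) x.
Proof. by rewrite tlact_class /tensor_prod lractA. Qed.

Lemma tensor_prod_ract A A' B X (a : hom A' A) (e : E X B) (x : F A X) :
  ract tensor_bifunctor (tensor_prod e x) a = tensor_prod e (x *r a).
Proof. by rewrite tract_class /tensor_prod lractA. Qed.

End Step.

(* ExtS E n is E^(n+1). *)
Fixpoint ExtS (E : bifunctor C) (n : nat) : bifunctor C :=
  if n is m.+1 then tensor_bifunctor E (ExtS E m) else E.

(* E^n for n >= 1, so that Ext E 1 = E and
   Ext E n.+2 = tensor_bifunctor E (Ext E n.+1); Ext E 0 is meaningless. *)
Definition Ext (E : bifunctor C) (n : nat) : bifunctor C := ExtS E n.-1.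

End HigherExtensions.

Definition seq_equiv (C : preaddCat) (A X B B' : C)
    (x : hom A B) (y : hom B X) (x' : hom A B') (y' : hom B' X) :=
  exists (b : hom B B') (b' : hom B' B),
    [/\ inverse_pair b b', b \oc x = x' & y' \oc b = y].

Section DirectSums.
Variables (C : preaddCat) (P : additiveStr C).

Definition bip_map A A' B B' (f : hom A B) (f' : hom A' B') :
    hom (bip P A A') (bip P B B') :=
  binl P B B' \oc f \oc bprl P A A' + binr P B B' \oc f' \oc bprr P A A'.

Definition ext_sum (E : bifunctor C) X X' A A' (d : E X A) (d' : E X' A') :
    E (bip P X X') (bip P A A') :=
  binl P A A' *l (d *r bprl P X X') + binr P A A' *l (d' *r bprr P X X').

End DirectSums.

(* realizes d x y: the sequence A -x-> B -y-> X belongs to the class s(d), for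
   d in E(X, A). *)
Record extriangulated := Extriangulated {
  et_cat :> preaddCat;
  et_add : additiveStr et_cat;
  et_E : bifunctor et_cat;
  realizes : forall (X A B : et_cat), et_E X A -> hom A B -> hom B X -> Prop;
  realizes_class : forall (X A : et_cat) (d : et_E X A),
    exists (B : et_cat) (x : hom A B) (y : hom B X),
    forall (B' : et_cat) (x' : hom A B') (y' : hom B' X),
      realizes d x' y' <-> seq_equiv x y x' y';
  realizes0 : forall A X : et_cat,
    realizes (0 : et_E X A) (binl et_add A X) (bprr et_add A X);
  realizes_sum : forall (X A B X' A' B' : et_cat)
      (d : et_E X A) (x : hom A B) (y : hom B X)
      (d' : et_E X' A') (x' : hom A' B') (y' : hom B' X'),
    realizes d x y -> realizes d' x' y' ->
    realizes (ext_sum et_add d d') (bip_map et_add x x') (bip_map et_add y y');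
  realizes_mor : forall (X A B X' A' B' : et_cat)
      (d : et_E X A) (x : hom A B) (y : hom B X)
      (d' : et_E X' A') (x' : hom A' B') (y' : hom B' X')
      (a : hom A A') (c : hom X X'),
    realizes d x y -> realizes d' x' y' -> a *l d = d' *r c ->
    exists b : hom B B', b \oc x = x' \oc a /\ y' \oc b = c \oc y;
  ET3 : forall (X A B X' A' B' : et_cat)
      (d : et_E X A) (x : hom A B) (y : hom B X)
      (d' : et_E X' A') (x' : hom A' B') (y' : hom B' X')
      (a : hom A A') (b : hom B B'),
    realizes d x y -> realizes d' x' y' -> b \oc x = x' \oc a ->
    exists c : hom X X', c \oc y = y' \oc b /\ a *l d = d' *r c;
  ET3op : forall (X A B X' A' B' : et_cat)
      (d : et_E X A) (x : hom A B) (y : hom B X)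
      (d' : et_E X' A') (x' : hom A' B') (y' : hom B' X')
      (b : hom B B') (c : hom X X'),
    realizes d x y -> realizes d' x' y' -> y' \oc b = c \oc y ->
    exists a : hom A A', b \oc x = x' \oc a /\ a *l d = d' *r c;
  ET4 : forall (A B X D F : et_cat)
      (d : et_E D A) (f : hom A B) (f' : hom B D)
      (d' : et_E F B) (g : hom B X) (g' : hom X F),
    realizes d f f' -> realizes d' g g' ->
    exists (Y : et_cat) (d'' : et_E Y A) (h' : hom X Y)
        (u : hom D Y) (v : hom Y F),
      realizes d'' (g \oc f) h' /\ u \oc f' = h' \oc g /\ v \oc h' = g' /\
      realizes (f' *l d') u v /\ d'' *r u = d /\ f *l d'' = d' *r v;
  ET4op : forall (A B X D F : et_cat)
      (d : et_E A D) (f' : hom D B) (f : hom B A)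
      (d' : et_E B F) (g' : hom F X) (g : hom X B),
    realizes d f' f -> realizes d' g' g ->
    exists (Y : et_cat) (d'' : et_E A Y) (h' : hom Y X)
        (u : hom Y D) (v : hom F Y),
      realizes d'' h' (f \oc g) /\ f' \oc u = g \oc h' /\ h' \oc v = g' /\
      realizes (d' *r f') v u /\ u *l d'' = d /\ d'' *r f = v *l d'
}.
Arguments et_E : clear implicits.

Record coproducts (I : Type) (C : preaddCat) := Coproducts {
  coprod : (I -> C) -> C;
  coinj : forall (B : I -> C) (i : I), hom (B i) (coprod B);
  copair : forall (B : I -> C) (X : C), (forall i, hom (B i) X) -> hom (coprod B) X;
  copairE : forall (B : I -> C) (X : C) (f : forall i, hom (B i) X) (i : I),
    copair f \oc coinj B i = f i;
  copair_uniq : forall (B : I -> C) (X : C) (f : forall i, hom (B i) X)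
      (h : hom (coprod B) X),
    (forall i, h \oc coinj B i = f i) -> h = copair f
}.
Arguments coprod {I C} c B.
Arguments coinj {I C} c B i.
Arguments copair {I C} c {B X} f.

Section Coproducts.
Variables (I : Type) (C : preaddCat) (K : coproducts I C).

Definition coprod_map (B B' : I -> C) (f : forall i, hom (B i) (B' i)) :
    hom (coprod K B) (coprod K B') :=
  copair K (fun i => coinj K B' i \oc f i).

Definition codiag (A : C) : hom (coprod K (fun=> A)) A :=
  copair K (fun=> idm A).

Definition kronecker (A : I -> C) (i j : I) : hom (A i) (A j) :=
  match pselect (i = j) with
  | left e => match e in _ = k return hom (A i) (A k) with erefl => idm (A i) end
  | right _ => 0
  end.

Definition coproj (A : I -> C) (j : I) : hom (coprod K A) (A j) :=
  copair K (fun i => kronecker A i j).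

End Coproducts.

Record AET4 (I : Type) (C : extriangulated) := MkAET4 {
  aet_coprod : coproducts I C;
  Gam : forall (B : I -> C) (A : C),
    dprod (fun i => et_E C (B i) A) ->
    et_E C (coprod aet_coprod B) (coprod aet_coprod (fun=> A));
  Gam_morph : forall B A, zmod_morphism (@Gam B A);
  Gam_nat : forall (B B' : I -> C) (A A' : C) (b : forall i, hom (B' i) (B i))
      (a : hom A A') (eta : forall i, et_E C (B i) A),
    Gam (fun i => a *l (eta i *r b i)) =
    coprod_map aet_coprod (fun=> a) *l (Gam eta *r coprod_map aet_coprod b);
  Gam_realizes : forall (B : I -> C) (A : C) (M : I -> C)
      (eta : forall i, et_E C (B i) A)
      (f : forall i, hom A (M i)) (g : forall i, hom (M i) (B i)),
    (forall i, realizes (eta i) (f i) (g i)) ->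
    realizes (Gam eta) (coprod_map aet_coprod f) (coprod_map aet_coprod g);
  Gam_inj : forall (B : I -> C) (A : C) (eta : forall i, et_E C (B i) A) (j : I),
    Gam eta *r coinj aet_coprod B j = coinj aet_coprod (fun=> A) j *l eta j
}.

(* The category Fun(I, C) of families, with the bifunctor
   F(D, D') = prod_i E(D_i, D'_i). *)
Section Families.
Variables (I : Type) (C : preaddCat).

Let fHom (D D' : I -> C) : zmodType := dprod (fun i => hom (D i) (D' i)).
Let fid (D : I -> C) : fHom D D := fun i => idm (D i).
Let fcomp (D D' D'' : I -> C) (g : fHom D' D'') (f : fHom D D') : fHom D D'' :=
  fun i => g i \oc f i.

Let fext (G : I -> zmodType) (x y : dprod G) : (forall i, x i = y i) -> x = y.
Proof. exact: functional_extensionality_dep. Qed.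

Definition famCat : preaddCat.
Proof.
refine (@PreaddCat (I -> C) fHom fid fcomp _ _ _ _ _).
- by move=> A B f; apply: fext => i; apply: comp1m.
- by move=> A B f; apply: fext => i; apply: compm1.
- by move=> A B D D' h g f; apply: fext => i; apply: compA.
- by move=> A B D g f f'; apply: fext => i; apply: compBr.
- by move=> A B D f g g'; apply: fext => i; apply: (compBl (f i)).
Defined.

Definition famBifunctor (E : bifunctor C) : bifunctor famCat.
Proof.
refine (@Bifunctor famCat (fun D D' => dprod (fun i => E (D i) (D' i)))
  (fun X A A' a d i => a i *l d i) (fun X X' A d c i => d i *r c i)
  _ _ _ _ _ _ _ _ _).
- by move=> X A d; apply: fext => i; apply: lact1.
- by move=> X A d; apply: fext => i; apply: ract1.
- by move=> X A A' A'' a' a d; apply: fext => i; apply: lactM.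
- by move=> X X' X'' A d c c'; apply: fext => i; apply: ractM.
- by move=> X X' A A' a d c; apply: fext => i; apply: lractA.
- by move=> X A A' a d d'; apply: fext => i; apply: lactBr.
- by move=> X A A' d a a'; apply: fext => i; apply: (lactBl (d i)).
- by move=> X X' A c d d'; apply: fext => i; apply: (ractBl (c i)).
- by move=> X X' A d c c'; apply: fext => i; apply: ractBr.
Defined.

Variable S : skeleton C.

Let frep_obj (r : I -> rep S) : famCat := fun i => rep_obj S (r i).

Let fam_iso (A B : famCat) : isomorphic A B <-> forall i, isomorphic (A i) (B i).
Proof.
split=> [[f [g [gf fg]]] i|h].
  exists (f i), (g i); split.
    by have /(congr1 (fun u : fHom A A => u i)) := gf.
  by have /(congr1 (fun u : fHom B B => u i)) := fg.
pose f : fHom A B := fun i => projT1 (cid (h i)).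
pose g : fHom B A := fun i => projT1 (cid (projT2 (cid (h i)))).
exists f, g; split; apply: fext => i; rewrite /= /fcomp /f /g;
  by case: (projT2 (cid (projT2 (cid (h i))))).
Qed.

Let frepP (A : famCat) : exists! r : I -> rep S, isomorphic A (frep_obj r).
Proof.
exists (fun i => rep_of S (A i)); split.
  by apply/fam_iso => i; apply: rep_of_iso.
move=> r /fam_iso hr; apply: functional_extensionality_dep => i.
have [r0 [_ u]] := repP S (A i).
by rewrite -(u _ (hr i)) -(u _ (rep_of_iso S (A i))).
Qed.

Definition famSkeleton : skeleton famCat := Skeleton frepP.

End Families.

(* The canonical homomorphism F^n(D, D') -> prod_i E^n(D_i, D'_i), which multiplies
   componentwise; indices are shifted as in ExtS. *)
Section Comparison.
Variables (I : Type) (C : preaddCat) (E : bifunctor C) (S : skeleton C).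

Local Notation ES := (ExtS S E).
Local Notation FS := (ExtS (famSkeleton I S) (famBifunctor I E)).

Fixpoint fam_compS (m : nat) : forall D D' : I -> C,
    FS m D D' -> dprod (fun i => ES m (D i) (D' i)) :=
  match m return forall D D' : I -> C,
      FS m D D' -> dprod (fun i => ES m (D i) (D' i)) with
  | 0 => fun D D' eta => eta
  | k.+1 => fun D D' =>
      @tlift _ (famSkeleton I S) (famBifunctor I E) (FS k) D D'
        (dprod (fun i => ES k.+1 (D i) (D' i)))
        (fun r e x i => tensor_prod S (e i) (fam_compS x i))
  end.

Lemma fam_compS_spec m :
  [/\ forall D D' : I -> C, zmod_morphism (@fam_compS m D D'),
      forall (X A A' : I -> C) (a : @hom (famCat I C) A A') (z : FS m X A) i,
        fam_compS (a *l z) i = a i *l fam_compS z i,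
      forall (X X' A : I -> C) (c : @hom (famCat I C) X' X) (z : FS m X A) i,
        fam_compS (z *r c) i = fam_compS z i *r c i &
      forall D D' : I -> C, balanced (S := famSkeleton I S) (E := famBifunctor I E)
        (F := FS m) (A := D) (B := D')
        (G := dprod (fun i => ES m.+1 (D i) (D' i)))
        (fun r e x i => tensor_prod S (e i) (fam_compS x i))].
Proof.
have bal k : (forall D D' : I -> C, zmod_morphism (@fam_compS k D D')) ->
    (forall (X A A' : I -> C) (a : @hom (famCat I C) A A') (z : FS k X A) i,
        fam_compS (a *l z) i = a i *l fam_compS z i) ->
    forall D D' : I -> C, balanced (S := famSkeleton I S) (E := famBifunctor I E)
      (F := FS k) (A := D) (B := D')
      (G := dprod (fun i => ES k.+1 (D i) (D' i)))
      (fun r e x i => tensor_prod S (e i) (fam_compS x i)).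
  move=> hB hl D D'; split=> [r x e e'|r e x x'|r r' h e x];
    apply: functional_extensionality_dep => i.
  - exact: (tensor_prodBl S (fam_compS x i)).
  - by rewrite hB; exact: (tensor_prodBr S (e i)).
  - by rewrite hl -tensor_prod_bal.
elim: m => [|m [hB hl hr hb]]; first by split=> //; apply: bal.
have kB (D D' : I -> C) : zmod_morphism (@fam_compS m.+1 D D').
  exact: (tlift_morph (hb D D')).
have kE (D D' : I -> C) (r : rep (famSkeleton I S))
    (e : famBifunctor I E (rep_obj _ r) D') (x : FS m D (rep_obj _ r)) i :
    @fam_compS m.+1 D D' (tclass e x) i = tensor_prod S (e i) (fam_compS x i).
  by rewrite /= tlift_class.
have kl (X A A' : I -> C) (a : @hom (famCat I C) A A') (z : FS m.+1 X A) i :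
    @fam_compS m.+1 _ _ (a *l z) i = a i *l fam_compS z i.
  move: z; apply: (@tensor_eq _ (famSkeleton I S) (famBifunctor I E) (FS m)
    X A (ES m.+1 (X i) (A' i)) (fun z => @fam_compS m.+1 X A' (lact (FS m.+1) a z) i)
    (fun z => lact (ES m.+1) (a i) (@fam_compS m.+1 X A z i))).
  - by move=> x y; rewrite lactBr kB.
  - by move=> x y; rewrite kB; exact: (lactBr (b := ES m.+1) (a i)
      (@fam_compS m.+1 X A x i) (@fam_compS m.+1 X A y i)).
  by move=> r e x; rewrite tlact_class !kE tensor_prod_lact.
split=> //; last exact: bal.
move=> X X' A c; move=> z i; move: z.
apply: (@tensor_eq _ (famSkeleton I S) (famBifunctor I E) (FS m)
  X A (ES m.+1 (X' i) (A i)) (fun z => @fam_compS m.+1 X' A (ract (FS m.+1) z c) i)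
  (fun z => ract (ES m.+1) (@fam_compS m.+1 X A z i) (c i))).
- by move=> x y; rewrite (ractBl c) kB.
- by move=> x y; rewrite kB; exact: (ractBl (b := ES m.+1) (c i)
      (@fam_compS m.+1 X A x i) (@fam_compS m.+1 X A y i)).
by move=> r e x; rewrite tract_class !kE tensor_prod_ract hr.
Qed.

Definition fam_comp (n : nat) (D D' : I -> C) :
    Ext (famSkeleton I S) (famBifunctor I E) n D D' ->
    dprod (fun i => Ext S E n (D i) (D' i)) :=
  @fam_compS n.-1 D D'.

(* The identification of prod_i E^n(D_i, D'_i) with F^n(D, D'): the inverse of
   fam_comp, that is, the z with fam_comp z = eta (the default 0 of xget plays
   no role, fam_comp being bijective when E comes from an extriangulated
   category). *)
Definition fam_ident (n : nat) (D D' : I -> C)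
    (eta : dprod (fun i => Ext S E n (D i) (D' i))) :
    Ext (famSkeleton I S) (famBifunctor I E) n D D' :=
  xget 0 [set z | fam_comp z = eta]%classic.

End Comparison.

Section CoproductLemmas.
Variables (I : Type) (C : preaddCat) (K : coproducts I C).

Lemma copair_ext (B : I -> C) (X : C) (f g : hom (coprod K B) X) :
  (forall i, f \oc coinj K B i = g \oc coinj K B i) -> f = g.
Proof. by move=> fg; rewrite (copair_uniq fg); apply/esym/copair_uniq. Qed.

Lemma coprod_mapE (B B' : I -> C) (f : forall i, hom (B i) (B' i)) i :
  coprod_map K f \oc coinj K B i = coinj K B' i \oc f i.
Proof. exact: copairE. Qed.

Lemma comp0m (A B D : C) (f : hom A B) : (0 : hom B D) \oc f = 0.
Proof. by have := compBl f (0 : hom B D) 0; rewrite !subrr. Qed.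

Lemma compm0 (A B D : C) (g : hom B D) : g \oc (0 : hom A B) = 0.
Proof. by have := compBr g (0 : hom A B) 0; rewrite !subrr. Qed.

Lemma kronecker_nat (A A' : I -> C) (a : forall i, hom (A i) (A' i)) i j :
  kronecker A' i j \oc a i = a j \oc kronecker A i j.
Proof.
rewrite /kronecker; case: pselect => [e|_]; last by rewrite comp0m compm0.
by case: _ / e; rewrite comp1m compm1.
Qed.

Lemma coproj_nat (A A' : I -> C) (a : forall i, hom (A i) (A' i)) j :
  coproj K A' j \oc coprod_map K a = a j \oc coproj K A j.
Proof.
apply: copair_ext => i; rewrite -!compA coprod_mapE compA !copairE.
exact: kronecker_nat.
Qed.

End CoproductLemmas.

Section CoproductFunctor.
Variables (I : Type) (C : extriangulated) (G : AET4 I C) (S : skeleton C).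

Local Notation K := (aet_coprod G).
Local Notation ES := (ExtS S (et_E C)).
Local Notation FS := (ExtS (famSkeleton I S) (famBifunctor I (et_E C))).

Definition sum_pi (A : I -> C) :
    hom (coprod K (fun=> coprod K A)) (coprod K A) :=
  copair K (fun j => coinj K A j \oc coproj K A j).

Definition Gam_S (B A : I -> C) (eta : dprod (fun i => et_E C (B i) (A i))) :
    et_E C (coprod K B) (coprod K A) :=
  sum_pi A *l Gam G (fun i => coinj K A i *l eta i).

Lemma sum_pi_nat (A A' : I -> C) (a : forall i, hom (A i) (A' i)) :
  sum_pi A' \oc coprod_map K (fun=> coprod_map K a) =
  coprod_map K a \oc sum_pi A.
Proof.
have piE (B : I -> C) j : sum_pi B \oc coinj K (fun=> coprod K B) j =
    coinj K B j \oc coproj K B j.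
  exact: (copairE K (fun j => coinj K B j \oc coproj K B j)).
apply: copair_ext => j.
rewrite -[LHS]compA (coprod_mapE K (fun=> coprod_map K a)) compA piE.
by rewrite -[RHS]compA piE -compA coproj_nat !compA coprod_mapE.
Qed.

Lemma Gam_S_morph (B A : I -> C) : zmod_morphism (@Gam_S B A).
Proof.
move=> eta eta'; rewrite /Gam_S -lactBr -Gam_morph; congr (_ *l Gam G _).
by apply: functional_extensionality_dep => i; apply: lactBr.
Qed.

Lemma Gam_S_nat (B B' A A' : I -> C) (b : forall i, hom (B' i) (B i))
    (a : forall i, hom (A i) (A' i)) (eta : dprod (fun i => et_E C (B i) (A i))) :
  Gam_S (fun i => a i *l (eta i *r b i)) =
  coprod_map K a *l (Gam_S eta *r coprod_map K b).
Proof.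
rewrite /Gam_S lractA -lactM -sum_pi_nat lactM -Gam_nat.
congr (_ *l Gam G _); apply: functional_extensionality_dep => i.
by rewrite lractA -!lactM coprod_mapE.
Qed.

Lemma Gam_S_lact (B A A' : I -> C) (a : forall i, hom (A i) (A' i))
    (eta : dprod (fun i => et_E C (B i) (A i))) :
  Gam_S (fun i => a i *l eta i) = coprod_map K a *l Gam_S eta.
Proof.
have := Gam_S_nat (fun i => idm (B i)) a eta.
have -> : coprod_map K (fun i => idm (B i)) = idm _.
  by apply: copair_ext => i; rewrite coprod_mapE comp1m compm1.
rewrite ract1 => <-; congr Gam_S; apply: functional_extensionality_dep => i.
by rewrite ract1.
Qed.

Lemma Gam_S_ract (B B' A : I -> C) (b : forall i, hom (B' i) (B i))
    (eta : dprod (fun i => et_E C (B i) (A i))) :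
  Gam_S (fun i => eta i *r b i) = Gam_S eta *r coprod_map K b.
Proof.
have := Gam_S_nat b (fun i => idm (A i)) eta.
have -> : coprod_map K (fun i => idm (A i)) = idm _.
  by apply: copair_ext => i; rewrite coprod_mapE comp1m compm1.
rewrite lact1 => <-; congr Gam_S; apply: functional_extensionality_dep => i.
by rewrite lact1.
Qed.

(* Determined by Gam_S^1 = Gam_S and
   Gam_S^(n+1) (e . x) = Gam_S e . Gam_S^n x; see Gam_SnS_spec. *)
Fixpoint Gam_SnS (m : nat) : forall D D' : I -> C,
    FS m D D' -> ES m (coprod K D) (coprod K D') :=
  match m return forall D D' : I -> C,
      FS m D D' -> ES m (coprod K D) (coprod K D') with
  | 0 => Gam_S
  | k.+1 => fun D D' =>
      @tlift _ (famSkeleton I S) (famBifunctor I (et_E C)) (FS k) D D'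
        (ES k.+1 (coprod K D) (coprod K D'))
        (fun r e x => tensor_prod S (Gam_S e) (Gam_SnS x))
  end.

Lemma Gam_SnS_spec m :
  [/\ forall D D' : I -> C, zmod_morphism (@Gam_SnS m D D'),
      forall (X A A' : I -> C) (a : @hom (famCat I C) A A') (z : FS m X A),
        Gam_SnS (a *l z) = coprod_map K a *l Gam_SnS z,
      forall (X X' A : I -> C) (c : @hom (famCat I C) X' X) (z : FS m X A),
        Gam_SnS (z *r c) = Gam_SnS z *r coprod_map K c &
      forall D D' : I -> C, balanced (S := famSkeleton I S)
        (E := famBifunctor I (et_E C)) (F := FS m) (A := D) (B := D')
        (G := ES m.+1 (coprod K D) (coprod K D'))
        (fun r e x => tensor_prod S (Gam_S e) (Gam_SnS x))].
Proof.
have bal k : (forall D D' : I -> C, zmod_morphism (@Gam_SnS k D D')) ->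
    (forall (X A A' : I -> C) (a : @hom (famCat I C) A A') (z : FS k X A),
        Gam_SnS (a *l z) = coprod_map K a *l Gam_SnS z) ->
    forall D D' : I -> C, balanced (S := famSkeleton I S)
      (E := famBifunctor I (et_E C)) (F := FS k) (A := D) (B := D')
      (G := ES k.+1 (coprod K D) (coprod K D'))
      (fun r e x => tensor_prod S (Gam_S e) (Gam_SnS x)).
  move=> hB hl D D'; split=> [r x e e'|r e x x'|r r' h e x].
  - rewrite Gam_S_morph; exact: (tensor_prodBl S (Gam_SnS x)).
  - by rewrite hB; exact: (tensor_prodBr S (Gam_S e)).
  - by rewrite hl -tensor_prod_bal -Gam_S_ract.
elim: m => [|m [hB hl hr hb]].
  by split; [exact: Gam_S_morph|move=> *; exact: Gam_S_lact|
    move=> *; exact: Gam_S_ract|apply: bal; [exact: Gam_S_morph|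
    move=> *; exact: Gam_S_lact]].
have kB (D D' : I -> C) : zmod_morphism (@Gam_SnS m.+1 D D').
  exact: (tlift_morph (hb D D')).
have kE (D D' : I -> C) (r : rep (famSkeleton I S))
    (e : famBifunctor I (et_E C) (rep_obj _ r) D') (x : FS m D (rep_obj _ r)) :
    @Gam_SnS m.+1 D D' (tclass e x) = tensor_prod S (Gam_S e) (Gam_SnS x).
  by rewrite /= tlift_class.
have kl (X A A' : I -> C) (a : @hom (famCat I C) A A') (z : FS m.+1 X A) :
    @Gam_SnS m.+1 _ _ (a *l z) = coprod_map K a *l Gam_SnS z.
  move: z; apply: (@tensor_eq _ (famSkeleton I S) (famBifunctor I (et_E C)) (FS m)
    X A (ES m.+1 (coprod K X) (coprod K A'))
    (fun z => @Gam_SnS m.+1 X A' (lact (FS m.+1) a z))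
    (fun z => lact (ES m.+1) (coprod_map K a) (@Gam_SnS m.+1 X A z))).
  - by move=> x y; rewrite lactBr kB.
  - by move=> x y; rewrite kB lactBr.
  by move=> r e x; rewrite tlact_class !kE tensor_prod_lact -Gam_S_lact.
split=> //; last exact: bal.
move=> X X' A c z; move: z.
apply: (@tensor_eq _ (famSkeleton I S) (famBifunctor I (et_E C)) (FS m)
  X A (ES m.+1 (coprod K X') (coprod K A))
  (fun z => @Gam_SnS m.+1 X' A (ract (FS m.+1) z c))
  (fun z => ract (ES m.+1) (@Gam_SnS m.+1 X A z) (coprod_map K c))).
- by move=> x y; rewrite (ractBl c) kB.
- by move=> x y; rewrite kB (ractBl (coprod_map K c)).
by move=> r e x; rewrite tract_class !kE tensor_prod_ract hr.
Qed.

Definition Gam_Sn (n : nat) (D D' : I -> C) :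
    Ext (famSkeleton I S) (famBifunctor I (et_E C)) n D D' ->
    Ext S (et_E C) n (coprod K D) (coprod K D') :=
  @Gam_SnS n.-1 D D'.

Definition tau (n : nat) (D : I -> C) (A : C)
    (eta : Ext S (et_E C) n (coprod K D) A) :
    dprod (fun i => Ext S (et_E C) n (D i) A) :=
  fun i => eta *r coinj K D i.

Definition sigma (n : nat) (D : I -> C) (A : C)
    (eta : dprod (fun i => Ext S (et_E C) n (D i) A)) :
    Ext S (et_E C) n (coprod K D) A :=
  codiag K A *l Gam_Sn (fam_ident (D' := fun=> A) eta).

End CoproductFunctor.
Arguments tau {I C} G S n {D A} eta.
Arguments sigma {I C} G S n {D A} eta.

(* Main.v *)
From HB Require Import structures.
Require Import Defs.
From mathcomp Require Import all_boot ssralg ssrint.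
From mathcomp Require Import generic_quotient ring_quotient.
From mathcomp Require Import boolp classical_sets.
From mathcomp Require Import freeg.
Set Implicit Arguments.
Unset Strict Implicit.
Unset Printing Implicit Defensive.
Import GRing.Theory.
Local Open Scope ring_scope.

(** Call y a deflation of e when e is realized by a sequence whose second map
is y. Since tau^n is restriction along the injections mu_i, it is additive and
natural, so that it suffices to prove two facts: sigma^n is a section of
tau^n, and tau^n is injective. Additivity and naturality of sigma^n then
follow from those of tau^n.

The first fact is the identity Gamma_S^n(z).mu_j = mu_j.z_j (Gam_SnS_inj): it
follows from condition (2) of AET4 in degree 1, and passes to products one
factor at a time. For it to say something about sigma^n, each family (eta_i) in
prod_i E^n(D_i, C) has to come from F^n(D, TC); it does, because an element of
E^(n+1) is a single product e.x rather than a sum of products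
(tensor_prodP), so that the factorizations can be chosen index by index
(fam_compS_surj).

The second fact (coinj_detect) is proved by induction on n. If e in
E(coprod D, C) satisfies e.mu_i = 0 for all i, each mu_i factors through the
deflation y of e, hence so does the identity of coprod D, and e.y = 0 gives
e = 0. If z = e.x in E^(n+1) satisfies e.(x.mu_i) = 0 for all i, then
x.mu_i = y.w_i with y a deflation of e. As tau^n is already onto, the w_i are
w.mu_i for a single w, and x = y.w by the induction hypothesis, whence
z = (e.y).w = 0.

The induction step rests on half of the long exact sequence of higher
extensions: e.x = 0 implies that x is the image of some w under a morphism
that e kills (tensor_prod_exact). For fixed B, the right module E(-, B) is the
directed union of its cyclic submodules e.Hom(-, X), two elements e1, e2 being
restrictions of one element on the direct sum. Tensoring with F = E^n turns
the cyclic submodule of e into the cokernel of F(A, M) -> F(A, X), where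
M -> X is a deflation of e. Thus e.x = 0 means that f.x vanishes in the
cokernel for some e' with e'.f = e (tclass_eq0). The maps between these
cokernels are injective: (ET4op) makes a homotopy pullback of f and a deflation
of e' into a realized sequence, and F is exact in the middle on it. Exactness
of E^n in the middle (half_exact_Ext) is in turn obtained by induction from
tensor_prod_exact and (ET4). *)

(** * Zero and sums under the two actions *)

Lemma zmorph0 (U V : zmodType) (f : U -> V) : zmod_morphism f -> f 0 = 0.
Proof. by move=> hf; have := hf 0 0; rewrite !subrr. Qed.

Section Actions.
Variables (C : preaddCat) (E : bifunctor C).

Lemma lactD X A A' (a : hom A A') :
  {morph (fun d : E X A => a *l d) : d d' / d + d'}.
Proof. exact: zmorphD (lactBr a). Qed.

Lemma lact0 X A A' (a : hom A A') : a *l (0 : E X A) = 0.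
Proof. exact: zmorph0 (lactBr a). Qed.

Lemma lact0m X A A' (d : E X A) : (0 : hom A A') *l d = 0.
Proof. exact: zmorph0 (lactBl d). Qed.

Lemma lactDm X A A' (d : E X A) :
  {morph (fun a : hom A A' => a *l d) : a b / a + b}.
Proof. exact: zmorphD (lactBl d). Qed.

Lemma ractD X X' A (c : hom X' X) :
  {morph (fun d : E X A => d *r c) : d d' / d + d'}.
Proof. exact: zmorphD (ractBl c). Qed.

Lemma ract0 X X' A (c : hom X' X) : (0 : E X A) *r c = 0.
Proof. exact: zmorph0 (ractBl c). Qed.

Lemma ractm0 X X' A (d : E X A) : d *r (0 : hom X' X) = 0.
Proof. exact: zmorph0 (ractBr d). Qed.

Lemma ractDm X X' A (d : E X A) :
  {morph (fun c : hom X' X => d *r c) : c b / c + b}.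
Proof. exact: zmorphD (ractBr d). Qed.

End Actions.

(** * Products of extensions that vanish *)

Section Directedness.
Local Open Scope quotient_scope.
Variables (C : preaddCat) (P : additiveStr C) (E : bifunctor C).

Definition ext_copair X1 X2 B (e1 : E X1 B) (e2 : E X2 B) : E (bip P X1 X2) B :=
  e1 *r bprl P X1 X2 + e2 *r bprr P X1 X2.

Lemma ext_copairl X1 X2 B (e1 : E X1 B) (e2 : E X2 B) :
  ext_copair e1 e2 *r binl P X1 X2 = e1.
Proof. by rewrite ractD -!ractM bprl_binl bprr_binl ract1 ractm0 addr0. Qed.

Lemma ext_copairr X1 X2 B (e1 : E X1 B) (e2 : E X2 B) :
  ext_copair e1 e2 *r binr P X1 X2 = e2.
Proof. by rewrite ractD -!ractM bprl_binr bprr_binr ract1 ractm0 add0r. Qed.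

Definition factors X X' B (e : E X B) (e' : E X' B) := exists f, e' *r f = e.

Lemma factors_trans X X' X'' B (e : E X B) (e' : E X' B) (e'' : E X'' B) :
  factors e e' -> factors e' e'' -> factors e e''.
Proof. by move=> [f <-] [g <-]; exists (g \oc f); rewrite ractM. Qed.

(** Only meaningful when factors e e'; otherwise it is 0. *)
Definition lift_of X X' B (e' : E X' B) (e : E X B) : hom X X' :=
  xget 0 [set f | e' *r f = e]%classic.

Lemma lift_ofP X X' B (e' : E X' B) (e : E X B) :
  factors e e' -> e' *r lift_of e' e = e.
Proof.
case=> f hf.
by apply: (@xgetPex _ 0 [set f | e' *r f = e]%classic); exists f.
Qed.

Variable F : bifunctor C.

(** When e has a deflation M -> X, these z form the image of F(A, M) in
F(A, X): every morphism killed by e factors through that deflation. Quantifying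
over all such morphisms avoids the choice of a realization, and makes sense
for any bifunctor E. *)
Definition null_image X A B (e : E X B) (z : F A X) :=
  exists M (y : hom M X) (w : F A M), e *r y = 0 /\ z = y *l w.

Lemma null_imageI X X' A B (e : E X B) (f : hom X' X) (z : F A X') :
  e *r f = 0 -> null_image e (f *l z).
Proof. by move=> ef0; exists X', f, z. Qed.

Lemma null_image_closed X A B (e : E X B) (z z' : F A X) :
  null_image e z -> null_image e z' -> null_image e (z - z').
Proof.
move=> [M [y [w [ey ->]]]] [M' [y' [w' [ey' ->]]]].
exists (bip P M M'), (y \oc bprl P M M' - y' \oc bprr P M M'),
  (binl P M M' *l w + binr P M M' *l w'); split.
  by rewrite ractBr !ractM ey ey' !ract0 subrr.
rewrite [in RHS]lactD !(lactBl _ (y \oc _)) -!lactM -!Defs.compA.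
rewrite bprl_binl bprr_binl bprl_binr bprr_binr !compm1 !compm0 !lact0m.
by rewrite subr0 sub0r.
Qed.

Variable S : skeleton C.

(** Two products e1.x1 and e2.x2 add up to the single product of
[e1, e2] : E(X1 + X2, B) and (x1, x2), and the coefficient k of a generator is
absorbed in its first factor. *)
Lemma tensor_prodP A B (t : tensor S E F A B) :
  exists X (e : E X B) (x : F A X), t = tensor_prod S e x.
Proof.
pose p z : tensor S E F A B :=
  \pi_(Quotient.quot (gen_subgroup (@tensor_rel _ S E F A B))) z.
have pB : zmod_morphism p by move=> z z'; apply: pres_piB.
pose pM : {additive _ -> _} := HB.pack p (GRing.isZmodMorphism.Build _ _ p pB).
move: t; apply: quotW => z; rewrite -[\pi z]/(p z); move: z.
apply: freeg_ind_dom0 => [|k [r [e x]] D _ _ [X [e' [x' pD]]]].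
  by exists B, 0, 0; rewrite (zmorph0 pB) (zmorph0 (tensor_prodBr _ _)).
exists (bip P (rep_obj S r) X), (ext_copair (e *~ k) e'),
  (binl P _ _ *l x + binr P _ _ *l x').
rewrite (zmorphD pB) pD (zmorphD (tensor_prodBr _ _)) -!tensor_prod_bal.
rewrite ext_copairl ext_copairr tensor_prod_rep; congr (_ + _).
have kU (g : tensor_gens S E F A B) :
    << k *g g >> = << g >> *~ k :> {freeg (tensor_gens S E F A B) / int}.
  by rewrite freegU_mulz intz.
rewrite kU; have -> (g : {freeg (tensor_gens S E F A B) / int}) :
    p (g *~ k) = p g *~ k.
  exact: (raddfMz pM k g).
pose q e1 : tensor S E F A B := tclass e1 x.
have qB : zmod_morphism q.
  by have [h _ _] := tclass_balanced S E F A B; apply: h.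
pose qM : {additive _ -> _} := HB.pack q (GRing.isZmodMorphism.Build _ _ q qB).
exact: esym (raddfMz qM k e).
Qed.

(** To each e' in E(X, B) belongs a homomorphism L e' from the free group on the
generators to F(A, X), which sends a generator e1.x1 with e1 = e'.f to f.x1.
The choice of f changes the value by a null image only. Each of the
defining relations is sent to a null image as soon as e' is large, that is,
as soon as the factors occurring in the relation factor through e'. As direct
sums make the e' directed, the elements that are eventually sent to null images
form a subgroup, which thus contains every z that vanishes in the tensor
product. *)
Lemma tclass_eq0 A B r (e : E (rep_obj S r) B) (x : F A (rep_obj S r)) :
  tclass e x = 0 ->
  exists X (e' : E X B) (f : hom (rep_obj S r) X),
    e' *r f = e /\ null_image e' (f *l x).
Proof.
pose L X (e' : E X B) : {freeg (tensor_gens S E F A B) / int} -> F A X :=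
  fglift ((fun g : tensor_gens S E F A B =>
    lift_of e' (projT2 g).1 *l (projT2 g).2) : _ -> zmodule (F A X)).
have LB X (e' : E X B) : zmod_morphism (L X e').
  exact: (lift_is_additive (M := zmodule (F A X))).
have LE X (e' : E X B) r' (e1 : E (rep_obj S r') B) x1 :
    L X e' << tgen e1 x1 >> = lift_of e' e1 *l x1.
  by rewrite /L liftU scale1r.
pose Q (z : {freeg (tensor_gens S E F A B) / int}) := exists X0 (e0 : E X0 B),
  forall X (e' : E X B), factors e0 e' -> null_image e' (L X e' z).
have Qc : zmod_closed (fun z => `[< Q z >]).
  split=> [|z z'].
    apply/asboolP; exists B, 0 => X e' _; rewrite zmorph0 //.
    rewrite -(lact0m X (0 : F A X)).
    by apply: null_imageI; rewrite ractm0.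
  move=> /asboolP [X0 [e0 h]] /asboolP [X1 [e1 h1]]; apply/asboolP.
  exists (bip P X0 X1), (ext_copair e0 e1) => X e' he.
  rewrite LB; apply: null_image_closed; [apply: h|apply: h1].
    by apply: factors_trans he; exists (binl P X0 X1); exact: ext_copairl.
  by apply: factors_trans he; exists (binr P X0 X1); exact: ext_copairr.
pose QM : zmodClosed {freeg (tensor_gens S E F A B) / int} :=
  HB.pack (fun z => `[< Q z >]) (GRing.isZmodClosed.Build _ _ Qc).
have QR z : tensor_rel z -> z \in QM.
  move=> hz; apply/asboolP; case: hz => [r' e1 e2 x1|r' e1 x1 x2|r1 r2 f e1 x1].
  - pose P12 := ext_copair (ext_copair e1 e2) (e1 + e2).
    exists _, P12 => X e' he.
    have [h1 h2 h3] : [/\ factors e1 e', factors e2 e' & factors (e1 + e2) e'].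
      split; apply: factors_trans he.
      + by exists (binl P _ _ \oc binl P _ _); rewrite ractM !ext_copairl.
      + exists (binl P _ _ \oc binr P _ _).
        by rewrite ractM ext_copairl ext_copairr.
      + by exists (binr P _ _); rewrite ext_copairr.
    rewrite LB (zmorphD (@LB _ _)) !LE -lactDm -[X in null_image _ X]lactBl.
    by apply: null_imageI; rewrite ractBr ractDm !lift_ofP // subrr.
  - exists B, 0 => X e' _.
    rewrite LB (zmorphD (@LB _ _)) !LE lactD subrr -(lact0m X (0 : F A X)).
    by apply: null_imageI; rewrite ractm0.
  - exists _, e1 => X e' h1.
    have h2 : factors (e1 *r f) e' by apply: factors_trans h1; exists f.
    rewrite LB !LE -lactM -[X in null_image _ X]lactBl.
    by apply: null_imageI; rewrite ractBr ractM !lift_ofP // subrr.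
move=> h0.
have /asboolP /(_ QM QR) /asboolP [X0 [e0 h]] :
    << tgen e x >> \in gen_subgroup (@tensor_rel _ S E F A B).
  rewrite -[X in X \in _]subr0 Quotient.idealrBE; apply/eqP.
  exact: etrans h0 (esym (zmorph0 (@pres_piB _ (@tensor_rel _ S E F A B)))).
pose e' := ext_copair e0 e; exists _, e', (lift_of e' e).
have he : factors e e' by exists (binr P _ _); rewrite ext_copairr.
split; first exact: lift_ofP.
by rewrite -LE; apply: h; exists (binl P _ _); rewrite ext_copairl.
Qed.

Lemma tensor_prod_eq0 A B X (e : E X B) (x : F A X) :
  tensor_prod S e x = 0 ->
  exists X' (e' : E X' B) (f : hom X X'), e' *r f = e /\ null_image e' (f *l x).
Proof.
move=> /tclass_eq0 [X' [e' [f [ef]]]]; rewrite -lactM => fx.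
exists X', e', (f \oc to_rep S X); split=> //.
by rewrite ractM ef -ractM (proj1 (to_repK S X)) ract1.
Qed.

End Directedness.

(** * Exact sequences in an extriangulated category *)

Section ExactSequences.
Variable C : extriangulated.
Local Notation E := (et_E C).
Local Notation P := (et_add C).

Lemma realizable (X A : C) (d : E X A) :
  exists (B : C) (x : hom A B) (y : hom B X), realizes d x y.
Proof.
have [B [x [y h]]] := realizes_class d; exists B, x, y; apply/h.
by exists (idm B), (idm B); rewrite /inverse_pair !comp1m compm1.
Qed.

(** (ET3) for the square from the split sequence A -> A + 0 -> 0 to the given
one: the induced map on the third terms starts at a zero object. *)
Lemma deflation_inflation (X A B : C) (d : E X A) (x : hom A B) (y : hom B X) :
  realizes d x y -> y \oc x = 0.
Proof.
move=> hd; have hb : x \oc bprl P A (zob P) \oc binl P A (zob P) = x \oc idm A.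
  by rewrite -Defs.compA bprl_binl.
have [c [hc _]] := ET3 (realizes0 A (zob P)) hd hb.
have := congr1 (fun h => h \oc binl P A (zob P)) hc.
by rewrite -!Defs.compA bprr_binl bprl_binl compm0 compm1.
Qed.

(** (ET3op) for the map from the split sequence A -> A + B -> B that is (x, 1)
on the middle terms and y on the third ones: it exhibits d.y as a pushout of
the zero extension. *)
Lemma ext_deflation (X A B : C) (d : E X A) (x : hom A B) (y : hom B X) :
  realizes d x y -> d *r y = 0.
Proof.
move=> hd; pose b := x \oc bprl P A B + bprr P A B.
have hb : y \oc b = y \oc bprr P A B.
  rewrite (zmorphD (compBr y)) Defs.compA (deflation_inflation hd).
  by rewrite comp0m add0r.
by have [a [_ <-]] := ET3op (realizes0 A B) hd hb; rewrite lact0.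
Qed.

(** The pullback of d along f splits, so f lifts to the middle term. *)
Lemma factor_deflation (X A B Z : C) (d : E X A) (x : hom A B) (y : hom B X)
    (f : hom Z X) :
  realizes d x y -> d *r f = 0 -> exists k : hom Z B, f = y \oc k.
Proof.
move=> hd df; have h0 : idm A *l (0 : E Z A) = d *r f by rewrite lact0.
have [b [_ hb]] := realizes_mor (realizes0 A Z) hd h0.
exists (b \oc binr P A Z).
by rewrite Defs.compA hb -Defs.compA bprr_binr compm1.
Qed.

Definition half_exact (F : bifunctor C) :=
  forall (X A B : C) (d : E X A) (i : hom A B) (p : hom B X), realizes d i p ->
  forall (Y : C) (z : F Y B), p *l z = 0 -> exists w : F Y A, z = i *l w.

(** Realize z by B -> Z -> Y and compose the inflations A -> B -> Z: (ET4) gives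
d'' with i.d'' = z.v, where v is a deflation of p.z = 0 and so has a section
s; the preimage is d''.s. *)
Lemma half_exact_E : half_exact E.
Proof.
move=> X A B d i p hd Y z pz.
have [Z [g [g' hz]]] := realizable z.
have [W [d'' [h' [u [v [_ [_ [_ [hv [_ iv]]]]]]]]]] := ET4 hd hz.
have [|s vs] := factor_deflation (f := idm Y) hv; first by rewrite pz ract0.
by exists (d'' *r s); rewrite -lractA iv -ractM -vs ract1.
Qed.

Variable S : skeleton C.

(** By tensor_prod_eq0, f.x comes from an object over X' that e' kills, for some
f with e = e'.f, and it remains to descend from e' to e. Let d' in
E(X + X', B) be [e, e']. (ET4op), applied to a realization of d' with deflation
g : W -> X + X' and to the split sequence X -> X + X' -> X', gives a realized
sequence Y -> W -> X' together with a deflation u : Y -> X of e = d'.binl. So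
Y is a homotopy pullback of f and a deflation of e'. The image of x in
F(A, X + X') lifts to W, since it is the sum of a part coming from
binl - binr f, which d' kills, and of binr.(f.x). The lift vanishes in F(A, X'),
so it comes from Y. *)
Lemma tensor_prod_exact (F : bifunctor C) A B X (e : E X B) (x : F A X) :
  half_exact F -> tensor_prod S e x = 0 -> null_image e x.
Proof.
move=> hF /(tensor_prod_eq0 P) [X' [e' [f [ef [M' [y' [z [ey' fx]]]]]]]].
pose d' := e' *r (f \oc bprl P X X' + bprr P X X').
have [W [g' [g hd']]] := realizable d'.
(* u is a deflation of d'.binl, and binl.u = g.h'. *)
have [Y [d'' [h' [u [v [hh [uh [_ [hu _]]]]]]]]] := ET4op (realizes0 X X') hd'.
have de : d' *r binl P X X' = e.
  rewrite -ractM (zmorphD (compBl _)) -Defs.compA bprl_binl bprr_binl.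
  by rewrite compm1 addr0.
have dr : d' *r binr P X X' = e'.
  rewrite -ractM (zmorphD (compBl _)) -Defs.compA bprl_binr bprr_binr.
  by rewrite compm0 add0r ract1.
have [|k hk] := factor_deflation (f := binl P X X' - binr P X X' \oc f) hd'.
  by rewrite ractBr ractM de dr ef subrr.
have [|k' hk'] := factor_deflation (f := binr P X X' \oc y') hd'.
  by rewrite ractM dr.
have gt : g *l (k *l x + k' *l z) = binl P X X' *l x.
  rewrite lactD -!lactM -hk -hk' lactBl !lactM fx.
  by rewrite -lactM subrK.
have [|w hw] := hF _ _ _ _ _ _ hh _ (k *l x + k' *l z).
  by rewrite lactM gt -lactM bprr_binl lact0m.
exists Y, u, w; split.
  by have := ext_deflation hu; rewrite de.
rewrite -[LHS]lact1 -(bprl_binl P X X') lactM -gt hw -!lactM -Defs.compA -uh.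
by rewrite Defs.compA bprl_binl comp1m.
Qed.

(** If p.(e.x) = (p.e).x vanishes, x can be moved across a y that p.e kills;
then p kills e.y, which comes from E(M, A) by exactness in degree 1. *)
Lemma half_exact_tensor (F : bifunctor C) :
  half_exact F -> half_exact (tensor_bifunctor S E F).
Proof.
move=> hF X A B d i p hd Y t.
have [Z [e [x ->]]] := tensor_prodP P t.
rewrite tensor_prod_lact => /(tensor_prod_exact hF) [M [y [w [pey ->]]]].
rewrite lractA in pey; have [e' ey] := half_exact_E hd pey.
by exists (tensor_prod S e' w); rewrite tensor_prod_lact -ey tensor_prod_bal.
Qed.

Lemma half_exact_Ext m : half_exact (ExtS S E m).
Proof.
by elim: m => [|m IH]; [exact: half_exact_E|exact: half_exact_tensor].
Qed.

End ExactSequences.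

(** * Families of extensions *)

Section FamilyProducts.
Variables (I : Type) (C : preaddCat) (E : bifunctor C) (S : skeleton C).
Local Notation fS := (famSkeleton I S).
Local Notation fE := (famBifunctor I E).

Lemma fam_compS_prod m (D D' X : famCat I C) (e : fE X D')
    (x : ExtS fS fE m D X) i :
  fam_compS (m := m.+1) (tensor_prod fS e x) i =
  tensor_prod S (e i) (fam_compS x i).
Proof.
have [_ hl _ hb] := fam_compS_spec I E S m.
rewrite /tensor_prod /= (tlift_class (hb D D')) hl tensor_prod_bal -lactM.
have /(congr1 (fun u : hom X X => u i)) := proj1 (to_repK fS X).
by move=> /= ->; rewrite lact1.
Qed.

(** A choice of one factorization e_i.x_i of each component suffices: the e_i
form an element of F, and the family of the x_i is lifted by induction. *)
Lemma fam_compS_surj (P : additiveStr C) m (D D' : famCat I C)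
    (eta : dprod (fun i => ExtS S E m (D i) (D' i))) :
  exists z, fam_compS z = eta.
Proof.
elim: m D' eta => [|m IH] D' eta; first by exists eta.
have h i : {X : C & {e : E X (D' i) & {x : ExtS S E m (D i) X |
    eta i = tensor_prod S e x}}}.
  have [X /cid [e /cid [x ->]]] := cid (tensor_prodP P (eta i)).
  by exists X, e, x.
pose e i := projT1 (projT2 (h i)).
have [x hx] := IH (fun i => projT1 (h i))
  (fun i => sval (projT2 (projT2 (h i)))).
exists (tensor_prod fS (e : fE _ _) x).
apply: functional_extensionality_dep => i.
by rewrite fam_compS_prod hx /e; case: (projT2 (projT2 (h i))).
Qed.

End FamilyProducts.

(** * Extensions of a coproduct *)

Section CoproductIso.
Variables (I : Type) (C : extriangulated) (G : AET4 I C) (S : skeleton C).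
Local Notation E := (et_E C).
Local Notation K := (aet_coprod G).
Local Notation fS := (famSkeleton I S).
Local Notation fE := (famBifunctor I E).

Lemma Gam_S_inj (D D' : I -> C) (eta : dprod (fun i => E (D i) (D' i))) j :
  Gam_S G eta *r coinj K D j = coinj K D' j *l eta j.
Proof.
rewrite lractA Gam_inj -!lactM.
rewrite (copairE K (fun j => coinj K D' j \oc coproj K D' j)).
rewrite -!Defs.compA copairE /kronecker; case: pselect => // e.
by rewrite (Prop_irrelevance e erefl) compm1.
Qed.

(** On a product e.x, the injection mu_j moves to the left through the two
factors: Gamma_S(e).Gamma_S^n(x).mu_j = Gamma_S(e).mu_j.x_j = mu_j.e_j.x_j. *)
Lemma Gam_SnS_inj m (D D' : famCat I C) (z : ExtS fS fE m D D') j :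
  Gam_SnS G z *r coinj K D j = coinj K D' j *l fam_compS z j.
Proof.
elim: m D' z => [|m IH] D' z; first exact: Gam_S_inj.
have [_ _ _ Gb] := Gam_SnS_spec G S m.
have [_ _ _ Fb] := fam_compS_spec I E S m.
have [GB _ _ _] := Gam_SnS_spec G S m.+1.
have [FB _ _ _] := fam_compS_spec I E S m.+1.
move: z; apply: (tensor_eq
  (f := fun z => ract (ExtS S E m.+1) (Gam_SnS G (m := m.+1) z) (coinj K D j))
  (g := fun z => lact (ExtS S E m.+1) (coinj K D' j)
    (fam_compS (m := m.+1) z j))).
- by move=> z z'; rewrite GB (ractBl _).
- by move=> z z'; rewrite FB; exact: (lactBr (b := ExtS S E m.+1)).
move=> r e x; rewrite /= (tlift_class (Gb D D')) (tlift_class (Fb D D')).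
apply: etrans (tensor_prod_ract S (coinj K D j) (Gam_S G e) (Gam_SnS G x)) _.
rewrite IH -tensor_prod_bal Gam_S_inj.
exact: esym (tensor_prod_lact S (coinj K D' j) (e j) (fam_compS x j)).
Qed.

(** By surjectivity of fam_compS, the default of the inverse fam_ident is never
taken, so Gam_SnS_inj applies to a z whose components are the eta_i. *)
Lemma tauS_sigmaS m (D : I -> C) (A : C) :
  cancel (sigma G S m.+1 (D := D) (A := A)) (tau G S m.+1).
Proof.
move=> eta; apply: functional_extensionality_dep => j.
have hz : fam_comp (fam_ident eta) = eta.
  exact: (xgetPex 0 (fam_compS_surj (et_add C) eta)).
rewrite /tau /sigma lractA Gam_SnS_inj -lactM copairE lact1.
exact: (congr1 (fun u : dprod _ => u j) hz).
Qed.

(** Injectivity of tau, in the form in which it is proved by induction on the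
degree. The step uses surjectivity in the previous degree to glue the w_i with
x.mu_i = y.w_i to one w. *)
Lemma coinj_detect m (D : I -> C) (A : C) (z : ExtS S E m (coprod K D) A) :
  (forall i, z *r coinj K D i = 0) -> z = 0.
Proof.
elim: m A z => [|m IH] A z hz.
  have [B [x [y hd]]] := realizable z.
  have h i : {s : hom (D i) B | coinj K D i = y \oc s}.
    exact: (cid (factor_deflation hd (hz i))).
  have ys : y \oc copair K (fun i => sval (h i)) = idm _.
    apply: copair_ext => i; rewrite -Defs.compA copairE comp1m.
    by case: (h i).
  by rewrite -(ract1 z) -ys ractM (ext_deflation hd) ract0.
have [X [e [x zE]]] := tensor_prodP (et_add C) z; subst z.
have [B [i [y hd]]] := realizable e.
have h j : {w : ExtS S E m (D j) B | x *r coinj K D j = y *l w}.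
  apply: cid; have := hz j; rewrite tensor_prod_ract.
  move=> /(tensor_prod_exact (@half_exact_Ext C S m)) [M [y' [w [ey' ->]]]].
  have [k ->] := factor_deflation hd ey'.
  by exists (k *l w); rewrite lactM.
pose w := sigma G S m.+1 (fun j => sval (h j)).
(* Then z = (e.y).w, and e kills its deflation y. *)
have -> : x = y *l w.
  apply/eqP; rewrite -subr_eq0; apply/eqP; apply: IH => j.
  have wj : w *r coinj K D j = sval (h j).
    exact: (congr1 (fun u : dprod _ => u j)
      (tauS_sigmaS (fun j => sval (h j)))).
  rewrite ractBl lractA wj; case: (h j) => s /= ->; exact: subrr.
rewrite -tensor_prod_bal (ext_deflation hd).
exact: zmorph0 (tensor_prodBl S w).
Qed.

End CoproductIso.

Theorem theorem3p7 (I : Type) (hI : inhabited I) (C : extriangulated)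
    (S : skeleton C) (G : AET4 I C) (n : nat) (hn : (1 <= n)%N) :
  [/\ forall (D : I -> C) (A : C),
        zmod_morphism (tau G S n : Ext S (et_E C) n (coprod (aet_coprod G) D) A ->
                                   dprod (fun i => Ext S (et_E C) n (D i) A)),
      forall (D : I -> C) (A : C),
        zmod_morphism (sigma G S n : dprod (fun i => Ext S (et_E C) n (D i) A) ->
                                     Ext S (et_E C) n (coprod (aet_coprod G) D) A),
      forall (D D' : I -> C) (A A' : C) (d : forall i, hom (D' i) (D i))
             (a : hom A A') (eta : Ext S (et_E C) n (coprod (aet_coprod G) D) A),
        tau G S n (a *l (eta *r coprod_map (aet_coprod G) d)) =
        (fun i => a *l (tau G S n eta i *r d i)),
      forall (D D' : I -> C) (A A' : C) (d : forall i, hom (D' i) (D i))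
             (a : hom A A') (eta : dprod (fun i => Ext S (et_E C) n (D i) A)),
        sigma G S n ((fun i => a *l (eta i *r d i))
                       : dprod (fun i => Ext S (et_E C) n (D' i) A')) =
        a *l (sigma G S n eta *r coprod_map (aet_coprod G) d) &
      forall (D : I -> C) (A : C),
        cancel (tau G S n : Ext S (et_E C) n (coprod (aet_coprod G) D) A ->
                            dprod (fun i => Ext S (et_E C) n (D i) A))
               (sigma G S n) /\
        cancel (sigma G S n : dprod (fun i => Ext S (et_E C) n (D i) A) ->
                              Ext S (et_E C) n (coprod (aet_coprod G) D) A)
               (tau G S n)].
Proof.
(* Ext S E n.+1 is ExtS S E n. *)
case: n hn => // m _.
have tauB (D : I -> C) (A : C) : zmod_morphism (@tau I C G S m.+1 D A).
  by move=> z z'; apply: functional_extensionality_dep => i; apply: ractBl.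
have tauK (D : I -> C) (A : C) : injective (@tau I C G S m.+1 D A).
  move=> z z' zz'; apply/eqP; rewrite -subr_eq0; apply/eqP.
  apply: (@coinj_detect I C G S m) => i.
  have := congr1 (fun u : dprod _ => u i) zz'; rewrite /tau (ractBl _) => ->.
  exact: subrr.
have tau_nat (D D' : I -> C) (A A' : C) (d : forall i, hom (D' i) (D i))
    (a : hom A A') (eta : Ext S (et_E C) m.+1 (coprod (aet_coprod G) D) A) :
    tau G S m.+1 (a *l (eta *r coprod_map (aet_coprod G) d)) =
    (fun i => a *l (tau G S m.+1 eta i *r d i)).
  apply: functional_extensionality_dep => i.
  by rewrite /tau lractA -!ractM coprod_mapE.
have sK (D : I -> C) (A : C) := @tauS_sigmaS I C G S m D A.
split=> //.
- by move=> D A z z'; apply: tauK; rewrite sK tauB !sK.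
- by move=> D D' A A' d a eta; apply: tauK; rewrite tau_nat !sK.
- by move=> D A; split=> [z|]; [apply: tauK; rewrite sK|exact: sK].
Qed.
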